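(* Let $p$ be an odd prime. Then the following assertions hold: (1) If $-1,2\in \mathcal{S}(p)$ and $3\in \mathcal{T}(p)$, then any graph can be decomposed into $K_1$, $K_2$, $K_3$ and $K_4$ over $\mathbb{F}_p$. (2) If $-1\in \mathcal{S}(p)$ and $2,3\in \mathcal{T}(p)$, then any graph can be decomposed into $K_1$, $K_2$, $K_3$, $K_4$ and $B$ over $\mathbb{F}_p$. (3) If $p \geq 5$, $3\in \mathcal{S}(p)$ and $-1\in \mathcal{T}(p)$, then any graph can be decomposed into $K_1$, $K_2$, $K_3$, $K_4$ and $C_5$ over $\mathbb{F}_p$. (4) If either $p \geq 5$ with $-1,3 \in \mathcal{T}(p)$, or $p=3$, then any graph can be decomposed into $K_1$, $K_2$, $K_3$ and $C_5$ over $\mathbb{F}_p$.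
   Context: Graphs are finite, undirected and simple. A graph $X$ is identified with its adjacency matrix (entry $1$ at $(u,v)$ if $uv$ is an edge, $0$ otherwise), regarded as a matrix over the field under consideration. For a prime $p$, $\mathbb{F}_p$ is the field with $p$ elements, $\mathbb{F}_p^\times=\mathbb{F}_p\setminus\{0\}$, $\mathcal{S}(p)=\{a^2 : a\in\mathbb{F}_p^\times\}$ and $\mathcal{T}(p)=\mathbb{F}_p^\times\setminus\mathcal{S}(p)$; integers are regarded as elements of $\mathbb{F}_p$ by reduction mod $p$. For square matrices, $M\oplus M'$ denotes the block diagonal matrix with blocks $M,M'$, and $nM$ denotes the direct sum $M\oplus\cdots\oplus M$ of $n$ copies of $M$. Symmetric matrices $M,M'$ over a field $k$ are called similar over $k$, written $M\sim M'$, if there is an invertible matrix $P$ over $k$ with $M'=P^tMP$ (i.e. they are congruent). A graph $X$ can be decomposed into graphs $X_1,\dots,X_s$ over $k$ if $X\sim n_1X_1\oplus\cdots\oplus n_sX_s$ over $k$ for some integers $n_i\geq 0$. $K_n$ is the complete graph on $n$ vertices, $C_5$ is the cycle of length $5$, and $B$ is the graph on $5$ vertices consisting of two triangles sharing exactly one vertex (vertices $o,a,b,c,d$; edges $oa,ob,oc,od,ab,cd$). *)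

(* Defs.v *)
(* MathComp *)
From mathcomp Require Import all_boot all_order all_algebra.

Set Implicit Arguments.
Unset Strict Implicit.
Unset Printing Implicit Defensive.

Import GRing.Theory.
Local Open Scope ring_scope.

Record sgraph := SGraph {
  vertex : finType;
  adj : rel vertex;
  adj_sym : symmetric adj;
  adj_irrefl : irreflexive adj
}.

(* Vertices are indexed in the order of [enum (vertex X)]; another order gives
   a congruent matrix. *)
Definition adjmx (F : fieldType) (X : sgraph) : 'M[F]_#|vertex X| :=
  \matrix_(i, j) (adj (enum_val i) (enum_val j))%:R.

(* The sizes m and n are only required to be propositionally equal, since the
   size of a direct sum is a sum that does not reduce to a given m. *)
Definition congruent (F : fieldType) (m n : nat) (M : 'M[F]_m) (M' : 'M[F]_n) :
    Prop :=
  exists (e : m = n) (P : 'M[F]_n),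
    P \in unitmx /\ M' = P^T *m castmx (e, e) M *m P.

Definition copies (F : fieldType) (n m : nat) (M : 'M[F]_m) :
    'M[F]_(\sum_(i < n) m) :=
  \mxdiag_(i < n) M.

(* The default value X of [nth] is never used, as i ranges over 'I_(size s). *)
Definition decomposable (F : fieldType) (X : sgraph) (s : seq sgraph) : Prop :=
  exists n : 'I_(size s) -> nat,
    congruent (adjmx F X)
      (\mxdiag_(i < size s) copies (n i) (adjmx F (nth X s i))).

Definition squares (p : nat) : {set 'F_p} :=
  [set a ^+ 2 | a in [set x : 'F_p | x != 0]].

Definition nonsquares (p : nat) : {set 'F_p} :=
  [set x : 'F_p | x != 0] :\: squares p.

Section ConcreteGraphs.

Variable n : nat.

Definition complete_adj : rel 'I_n := fun i j => i != j.

Lemma complete_adj_sym : symmetric complete_adj.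
Proof. by move=> i j; rewrite /complete_adj eq_sym. Qed.

Lemma complete_adj_irrefl : irreflexive complete_adj.
Proof. by move=> i; rewrite /complete_adj eqxx. Qed.

Definition Kn : sgraph := SGraph complete_adj_sym complete_adj_irrefl.

Variable E : seq (nat * nat).

(* The condition [i != j] makes the relation irreflexive for every list E; it
   is vacuous when E contains no diagonal pair. *)
Definition edges_adj : rel 'I_n := fun i j =>
  (i != j) && (((val i, val j) \in E) || ((val j, val i) \in E)).

Lemma edges_adj_sym : symmetric edges_adj.
Proof. by move=> i j; rewrite /edges_adj eq_sym orbC. Qed.

Lemma edges_adj_irrefl : irreflexive edges_adj.
Proof. by move=> i; rewrite /edges_adj eqxx. Qed.

Definition graph_of_edges : sgraph := SGraph edges_adj_sym edges_adj_irrefl.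

End ConcreteGraphs.

Definition C5 : sgraph :=
  graph_of_edges 5 [:: (0, 1); (1, 2); (2, 3); (3, 4); (4, 0)]%N.

(* Two triangles sharing the vertex 0. *)
Definition B : sgraph :=
  graph_of_edges 5 [:: (0, 1); (0, 2); (0, 3); (0, 4); (1, 2); (3, 4)]%N.

(* Main.v *)
Require Import Defs.
From mathcomp Require Import all_boot all_order all_algebra zify ring.

Set Implicit Arguments.
Unset Strict Implicit.
Unset Printing Implicit Defensive.

Import GRing.Theory.
Local Open Scope ring_scope.

(* Over a finite field of odd characteristic, symmetric matrices are classified
   up to congruence by their size, their rank and the square class of the
   discriminant of their nondegenerate part, and the last two are additive for
   direct sums. The nondegenerate part of an adjacency matrix is again the
   adjacency matrix of a graph, namely an induced subgraph. The rank of a graph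
   is therefore never 1, and a rank of at most 5 forces the discriminant to be
   one of the few determinants of graphs on that many vertices. For each p in
   the theorem the available blocks realise all the pairs that remain; K_1
   only provides the kernel. *)

(** * Squares in a finite field of odd characteristic *)

Section FiniteField.

Variable F : finFieldType.
Hypothesis two_neq0 : 2%:R != 0 :> F.

(** The quadratic character written additively, so that products of nonzero elements turn into
    [addb]; zero counts as a square. *)
Definition nonsquare (x : F) : bool := [forall c, x != c ^+ 2].

Lemma nonsquarePn (x : F) : reflect (exists c, x = c ^+ 2) (~~ nonsquare x).
Proof.
rewrite negb_forall; apply: (iffP existsP) => -[c].
  by rewrite negbK => /eqP ->; exists c.
by move=> ->; exists c; rewrite eqxx.
Qed.

Lemma nonsquare_sqr (c : F) : nonsquare (c ^+ 2) = false.
Proof. by apply/negbTE/nonsquarePn; exists c. Qed.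

Let units : {set F} := [set~ 0].
Let sq : {set F} := [set a ^+ 2 | a in units].

(* The squaring map is at most two-to-one; the boolean tells [x] from [- x]. *)
Lemma card_units_le_squares : (#|units| <= 2 * #|sq|)%N.
Proof.
pose g (x : F) := (x ^+ 2, (enum_rank x < enum_rank (- x))%N).
have injg : {in units &, injective g}.
  move=> x y; rewrite !inE => x0 _ [/eqP].
  rewrite eqf_sqr => /orP[/eqP //|/eqP xE].
  rewrite xE opprK => h.
  case: (ltngtP (enum_rank (- y)) (enum_rank y)) h => // /val_inj/enum_rank_inj yN _.
  by rewrite -xE in yN *.
have -> : (2 * #|sq| = #|setX sq [set: bool]|)%N by rewrite cardsX cardsT card_bool mulnC.
rewrite -(card_in_imset injg).
apply/subset_leq_card/subsetP => _ /imsetP[x xu ->].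
by rewrite !inE andbT; apply: imset_f.
Qed.

Lemma mem_sq (x : F) : (x \in sq) = (x != 0) && ~~ nonsquare x.
Proof.
apply/imsetP/andP => [[a a0 ->]|[x0 /nonsquarePn[c xE]]].
  by rewrite !inE in a0; rewrite expf_neq0 // nonsquare_sqr.
by exists c => //; rewrite !inE; apply: contraNneq x0; rewrite xE => ->; rewrite expr0n.
Qed.

(** A nonzero square factor is removed by dividing by its root, which leaves only the product of two
    nonsquares; that case is a count. *)
Lemma nonsquareM (x y : F) : x != 0 -> y != 0 ->
  nonsquare (x * y) = nonsquare x (+) nonsquare y.
Proof.
have sqM u v : u != 0 -> ~~ nonsquare u -> nonsquare (u * v) = nonsquare v.
  move=> u0 /nonsquarePn[c uE]; apply/idP/idP; apply: contraTT.
    by case/nonsquarePn => d ->; apply/nonsquarePn; exists (c * d); rewrite exprMn uE.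
  case/nonsquarePn => d uvE; apply/nonsquarePn; exists (d / c).
  by rewrite exprMn exprVn -uE -uvE mulrAC divff // mul1r.
move=> x0 y0; case nx: (nonsquare x); last by rewrite sqM ?nx.
case ny: (nonsquare y); last by rewrite mulrC sqM ?ny.
rewrite addbb; apply/negbTE/negP => nxy.
(* [sq] and [x * sq] are disjoint and already exhaust [units], so [x * y] is one too many. *)
pose xsq := [set x * a | a in sq].
have disj : [disjoint sq & xsq].
  apply/pred0P => a; apply/negbTE/negP => /= /andP[]; rewrite mem_sq => /andP[_ na].
  case/imsetP => b; rewrite mem_sq => /andP[b0 nb] aE.
  by move: na; rewrite aE mulrC sqM ?nx.
have cardx : #|xsq| = #|sq| by apply: card_imset; apply: mulfI.
have sub : x * y |: (sq :|: xsq) \subset units.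
  apply/subsetP => a; rewrite !inE mem_sq => /or3P[/eqP ->|/andP[] //|].
    exact: mulf_neq0.
  by case/imsetP => b; rewrite mem_sq => /andP[b0 _] ->; apply: mulf_neq0.
have := leq_trans (subset_leq_card sub) card_units_le_squares.
rewrite cardsU1 cardsU (disjoint_setI0 disj) cards0 cardx.
suff -> : x * y \notin sq :|: xsq by lia.
rewrite !inE mem_sq nxy andbF /=; apply/imsetP => -[b].
by rewrite mem_sq => /andP[_ nb] /(mulfI x0) yb; rewrite yb in ny; rewrite ny in nb.
Qed.

(* The values of [a x^2] and of [1 - b y^2] each fill more than half of [F]. *)
Lemma binary_form_represents1 (a b : F) : a != 0 -> b != 0 ->
  exists x y, a * x ^+ 2 + b * y ^+ 2 = 1.
Proof.
move=> a0 b0.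
pose A := [set a * c | c in 0 |: sq]; pose B := [set 1 - b * c | c in 0 |: sq].
have s0 : 0 \notin sq by rewrite mem_sq eqxx.
have cA : #|A| = #|sq|.+1.
  by rewrite card_imset ?cardsU1 ?s0 //; apply: mulfI.
have cB : #|B| = #|sq|.+1.
  by rewrite card_imset ?cardsU1 ?s0 // => u v /addrI/oppr_inj/(mulfI b0).
have cu : #|F| = #|units|.+1 by rewrite -cardsT (cardsD1 0) inE setTD.
have : ~~ [disjoint A & B].
  apply/negP => dAB; have := max_card (mem (A :|: B)).
  rewrite cardsU (disjoint_setI0 dAB) cards0 cA cB cu.
  have := card_units_le_squares; lia.
have sqE c : c \in 0 |: sq -> exists d, c = d ^+ 2.
  rewrite !inE mem_sq => /orP[/eqP ->|/andP[_ /nonsquarePn //]].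
  by exists 0; rewrite expr0n.
case/pred0Pn => z /= /andP[/imsetP[c /sqE[x ->] ->] /imsetP[d /sqE[y ->] zE]].
by exists x, y; rewrite zE subrK.
Qed.

End FiniteField.

(** * Congruence and splitting of symmetric matrices over a field *)

Section SymmetricForms.

Variable F : fieldType.

Definition congr_mx n (M M' : 'M[F]_n) : Prop :=
  exists2 P : 'M_n, P \in unitmx & M' = P^T *m M *m P.

Lemma congr_mx_sym n (M M' : 'M[F]_n) : congr_mx M M' -> congr_mx M' M.
Proof.
case=> P uP ->; exists (invmx P); first by rewrite unitmx_inv.
by rewrite !mulmxA -trmx_mul mulmxV // trmx1 mul1mx mulmxK.
Qed.

Lemma congr_mx_trans n (M M' M'' : 'M[F]_n) :
  congr_mx M M' -> congr_mx M' M'' -> congr_mx M M''.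
Proof.
case=> P uP -> [P' uP' ->]; exists (P *m P'); first by rewrite unitmx_mul uP.
by rewrite trmx_mul !mulmxA.
Qed.

Lemma congr_mx_symmetric n (M M' : 'M[F]_n) :
  congr_mx M M' -> M^T = M -> M'^T = M'.
Proof. by case=> P _ -> MT; rewrite !trmx_mul trmxK MT mulmxA. Qed.

Lemma congr_mx_unit n (M M' : 'M[F]_n) :
  congr_mx M M' -> M \in unitmx -> M' \in unitmx.
Proof. by case=> P uP -> uM; rewrite !unitmx_mul unitmx_tr uP uM. Qed.

Lemma congr_mx_block m n (M M' : 'M[F]_m) (N N' : 'M[F]_n) :
  congr_mx M M' -> congr_mx N N' ->
  congr_mx (block_mx M 0 0 N) (block_mx M' 0 0 N').
Proof.
case=> P uP -> [P' uP' ->]; exists (block_mx P 0 0 P').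
  by rewrite unitmxE det_ublock unitrM -!unitmxE uP.
by rewrite tr_block_mx !trmx0 !mulmx_block !(mulmx0, mul0mx, addr0, add0r).
Qed.

(** Both row spaces are all of [F^r]. The lemma serves to move one nonzero vector to another and to
    compare the tall factors of two degenerate forms. *)
Lemma row_full_left_equiv n r (Q Q' : 'M[F]_(n, r)) : row_full Q -> row_full Q' ->
  exists2 P : 'M_n, P \in unitmx & Q' = P *m Q.
Proof. by move=> fQ fQ'; apply/eqmxMunitP; rewrite !submx_full. Qed.

(** Take [x] as the first basis vector, then pass to its orthogonal complement, which exists because
    [a] is invertible. *)
Lemma symmetric_split n (N : 'M[F]_(1 + n)) (x : 'cV_(1 + n)) (a : F) :
  N^T = N -> N \in unitmx -> a != 0 -> x^T *m N *m x = a%:M ->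
  exists N1 : 'M_n, [/\ congr_mx N (block_mx a%:M 0 0 N1), N1^T = N1 & N1 \in unitmx].
Proof.
move=> NT uN a0 xE.
have x0 : x != 0.
  apply: contraNneq a0 => x0; move: xE; rewrite x0 mulmx0 => /matrixP/(_ 0 0).
  by rewrite !mxE eqxx mulr1n => ->.
pose e : 'cV[F]_(1 + n) := col_mx 1%:M 0.
have fx : row_full x by rewrite /row_full -mxrank_tr rank_rV trmx_eq0 x0.
have fe : row_full e.
  by apply/row_fullP; exists (row_mx 1%:M 0); rewrite mul_row_col mul1mx mul0mx addr0.
(* [P] maps the first basis vector [e] to [x], so the upper left entry of [P^T N P] is [a]. *)
have [P uP xP] := row_full_left_equiv fe fx.
pose N' := P^T *m N *m P.
have cN' : congr_mx N N' by exists P.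
have N'T := congr_mx_symmetric cN' NT.
have ulN' : ulsubmx N' = a%:M.
  rewrite -xE xP trmx_mul !mulmxA -(mulmxA _ P^T) -(mulmxA _ _ P) -/N'.
  rewrite -{2}[N']submxK tr_col_mx trmx1 trmx0 mul_row_block mul_row_col.
  by rewrite !(mul1mx, mul0mx, mulmx1, mulmx0, addr0).
pose u := ursubmx N'.
have dlN' : dlsubmx N' = u^T by rewrite /u trmx_ursub N'T.
(* The Schur complement of [a]; the unipotent matrix below clears the rest of the first row and
   column. *)
pose N1 := drsubmx N' - a^-1 *: (u^T *m u).
have cN1 : congr_mx N' (block_mx a%:M 0 0 N1).
  exists (block_mx 1%:M (- (a^-1 *: u)) 0 1%:M).
    by rewrite unitmxE det_ublock !det1 mulr1 unitr1.
  rewrite -[in RHS](submxK N') ulN' dlN' -/u tr_block_mx !trmx1 trmx0 !mulmx_block.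
  rewrite !(mul1mx, mulmx1, mul0mx, mulmx0, addr0, add0r).
  rewrite !(mulNmx, mulmxN) -!(scalemxAl, scalemxAr).
  have -> : (- (a^-1 *: u))^T = - (a^-1 *: u^T) by rewrite linearN /= linearZ.
  rewrite mul_mx_scalar mul_scalar_mx !scalerN !scalerA !mulfV //.
  rewrite !scale1r !addNr mul0mx ?oppr0 ?scaler0 ?oppr0 add0r mulNmx -scalemxAl.
  by rewrite mulVf // scale1r addNr [X in _ = block_mx _ _ _ X]addrC.
have c := congr_mx_trans cN' cN1.
exists N1; split=> //.
  have /= := congr_mx_symmetric c NT.
  by rewrite tr_block_mx => /eq_block_mx[].
have := congr_mx_unit c uN.
by rewrite unitmxE det_ublock unitrM -unitmxE => /andP[].
Qed.

(** Polarization: if the form vanishes at the basis vectors [d i] and [d j], its value at their sum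
    is twice the entry [N i j]. *)
Lemma symmetric_represents_nonzero n (N : 'M[F]_n) :
  2%:R != 0 :> F -> N^T = N -> N != 0 ->
  exists (x : 'cV_n) (a : F), a != 0 /\ x^T *m N *m x = a%:M.
Proof.
move=> two_neq0 NT N0.
have /existsP[i /existsP[j Nij]] : [exists i, exists j, N i j != 0].
  apply: contraNT N0 => /existsPn h; apply/eqP/matrixP => i j; rewrite mxE.
  by apply/eqP; move/existsPn/(_ j): (h i); rewrite negbK.
pose q (x : 'cV_n) := (x^T *m N *m x) 0 0.
have qE x : x^T *m N *m x = (q x)%:M by rewrite [LHS]mx11_scalar.
pose d k : 'cV[F]_n := delta_mx k 0.
have bE k l : ((d k)^T *m N *m d l) 0 0 = N k l.
  by rewrite trmx_delta -rowE -colE !mxE.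
have qD : q (d i + d j) = q (d i) + q (d j) + 2%:R * N i j.
  have Nji : N j i = N i j by rewrite -{1}NT mxE.
  rewrite /q [(d i + d j)^T]linearD /= !mulmxDl !mulmxDr mxE [X in X + _]mxE [X in _ + X]mxE.
  by rewrite !bE Nji; ring.
have [qi|] := eqVneq (q (d i)) 0; last by exists (d i), (q (d i)).
have [qj|] := eqVneq (q (d j)) 0; last by exists (d j), (q (d j)).
exists (d i + d j), (2%:R * N i j); rewrite mulf_neq0 //; split=> //.
by rewrite qE qD qi qj !add0r.
Qed.

End SymmetricForms.

(** * Classification of symmetric matrices over a finite field *)

Section FiniteFieldForms.

Variable F : finFieldType.
Hypothesis two_neq0 : 2%:R != 0 :> F.

(** Size at least two allows a nonzero value [a], and then a nonzero value [b] on the orthogonal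
    complement; the binary form with coefficients [a] and [b] represents 1. *)
Lemma symmetric_represents1 n (N : 'M[F]_n.+2) :
  N^T = N -> N \in unitmx -> exists x : 'cV_n.+2, x^T *m N *m x = 1%:M.
Proof.
have nz k (A : 'M[F]_k.+1) : A \in unitmx -> A != 0.
  by apply: contraTneq => ->; rewrite unitmxE det0 unitr0.
move=> NT uN; have [x [a [a0 xE]]] := symmetric_represents_nonzero two_neq0 NT (nz _ _ uN).
have [N1 [[P uP PE] N1T uN1]] := @symmetric_split _ n.+1 N x a NT uN a0 xE.
have [y [b [b0 yE]]] := symmetric_represents_nonzero two_neq0 N1T (nz _ _ uN1).
have [s [t st]] := binary_form_represents1 two_neq0 a0 b0.
(* The solution in the coordinates of the split form, carried back by [P]. *)
exists (P *m col_mx s%:M (t *: y)).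
rewrite trmx_mul !mulmxA -(mulmxA _ P^T) -(mulmxA _ _ P) -PE.
rewrite tr_col_mx mul_row_block mul_row_col !mulmx0 addr0 add0r.
rewrite [(t *: y)^T]linearZ /= -!scalemxAr -!scalemxAl yE tr_scalar_mx -!scalar_mxM.
by rewrite !scale_scalar_mx -raddfD /= -st; congr (_%:M); ring.
Qed.

(** Split off a 1 from both matrices until size one is reached; there the class of the single entry
    decides. *)
Lemma congr_mx_nonsquare_det n (N N' : 'M[F]_n) :
  N^T = N -> N'^T = N' -> N \in unitmx -> N' \in unitmx ->
  nonsquare (\det N) = nonsquare (\det N') -> congr_mx N N'.
Proof.
(* Congruence multiplies the determinant by the square of [\det P]. *)
have detc k (A A' : 'M[F]_k) : congr_mx A A' -> A \in unitmx ->
    nonsquare (\det A') = nonsquare (\det A).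
  case=> P uP ->; rewrite !unitmxE in uP * => uA.
  rewrite !det_mulmx det_tr mulrAC -expr2 nonsquareM ?nonsquare_sqr //.
    by rewrite expf_neq0 // -unitfE.
  by rewrite -unitfE.
elim: n N N' => [|[|n] IHn] N N' NT N'T uN uN'.
- by move=> _; exists 1%:M; [exact: unitmx1 | rewrite [N']flatmx0 [RHS]flatmx0].
- rewrite [N]mx11_scalar [N']mx11_scalar !det_scalar1 in uN uN' *.
  rewrite !unitmxE !det_scalar1 !unitfE in uN uN'.
  set a := N 0 0 in uN *; set b := N' 0 0 in uN' * => ab.
  have : ~~ nonsquare (a * b) by rewrite nonsquareM // ab addbb.
  (* From [a * b = c ^+ 2] it follows that scaling by [c / a] turns [a] into [b]. *)
  case/nonsquarePn => c cE; exists (c / a)%:M.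
    rewrite unitmxE det_scalar1 unitfE mulf_neq0 ?invr_eq0 //.
    by apply: contra_eqN cE => /eqP ->; rewrite expr0n mulf_neq0.
  rewrite tr_scalar_mx -!scalar_mxM; congr (_%:M).
  by apply: (mulfI uN); rewrite cE; field.
move=> detNN'.
have [x xE] := symmetric_represents1 NT uN.
have [y yE] := symmetric_represents1 N'T uN'.
have [N1 [cN N1T uN1]] := @symmetric_split _ n.+1 N x 1 NT uN (oner_neq0 _) xE.
have [N1' [cN' N1'T uN1']] := @symmetric_split _ n.+1 N' y 1 N'T uN' (oner_neq0 _) yE.
apply: (congr_mx_trans cN); apply: congr_mx_sym; apply: (congr_mx_trans cN').
apply: congr_mx_sym; apply: congr_mx_block.
  by exists 1%:M; rewrite ?unitmx1 // trmx1 !mulmx1.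
apply: IHn => //; have := detc _ _ _ cN uN; have := detc _ _ _ cN' uN'.
by rewrite !det_ublock !det1 !mul1r detNN' => -> ->.
Qed.

(* [r] is the rank of [M], and [b] tells whether the discriminant of its
   nondegenerate part is a nonsquare. *)
Definition form_class n (M : 'M[F]_n) (r : nat) (b : bool) : Prop :=
  exists (N : 'M_r) (Q : 'M_(n, r)),
    [/\ N^T = N, N \in unitmx, row_full Q, M = Q *m N *m Q^T
      & nonsquare (\det N) = b].

(** The congruence [S] between the nondegenerate parts is absorbed into [Q']; the two tall factors
    then differ by an invertible [P]. *)
Lemma form_class_congr n (M M' : 'M[F]_n) r b :
  form_class M r b -> form_class M' r b -> congr_mx M M'.
Proof.
case=> N [Q [NT uN fQ -> Nb]] [N' [Q' [N'T uN' fQ' -> N'b]]].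
have [S uS ->] := congr_mx_nonsquare_det NT N'T uN uN' (etrans Nb (esym N'b)).
have fQS : row_full (Q' *m S^T) by rewrite /row_full mxrankMfree // row_free_unit unitmx_tr.
have [P uP QP] := row_full_left_equiv fQ fQS.
exists P^T; first by rewrite unitmx_tr.
by rewrite trmxK !mulmxA -QP -!mulmxA -trmx_mul -QP trmx_mul trmxK !mulmxA.
Qed.

Lemma form_class_congruent m n (M : 'M[F]_m) (M' : 'M[F]_n) r b :
  m = n -> form_class M r b -> form_class M' r b -> congruent M M'.
Proof.
move=> e; case: _ / e in M' * => cM cM'.
have [P uP ->] := form_class_congr cM cM'.
by exists (erefl m), P; rewrite castmx_id.
Qed.

Lemma form_class_castmx m n (e : m = n) (M : 'M[F]_m) r b :
  form_class M r b -> form_class (castmx (e, e) M) r b.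
Proof. by case: _ / e; rewrite castmx_id. Qed.

Lemma form_class_unit n (M : 'M[F]_n) :
  M^T = M -> M \in unitmx -> form_class M n (nonsquare (\det M)).
Proof.
move=> MT uM; exists M, 1%:M; split=> //; last by rewrite trmx1 mulmx1 mul1mx.
by rewrite row_full_unit unitmx1.
Qed.

Lemma form_class_zero n : form_class (0 : 'M[F]_n) 0 false.
Proof.
exists 0, 0; split; rewrite ?trmx0 ?mul0mx ?det_mx00 //.
- by rewrite unitmxE det_mx00 unitr1.
- by rewrite /row_full mxrank0.
- by rewrite -(expr1n _ 2) nonsquare_sqr.
Qed.

Lemma form_class_block m n (M : 'M[F]_m) (M' : 'M[F]_n) r r' b b' :
  form_class M r b -> form_class M' r' b' ->
  form_class (block_mx M 0 0 M') (r + r') (b (+) b').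
Proof.
case=> N [Q [NT uN fQ -> <-]] [N' [Q' [N'T uN' fQ' -> <-]]].
exists (block_mx N 0 0 N'), (block_mx Q 0 0 Q'); split.
- by rewrite tr_block_mx !trmx0 NT N'T.
- by rewrite unitmxE det_ublock unitrM -!unitmxE uN.
- have [[L LQ] [L' LQ']] := (row_fullP fQ, row_fullP fQ').
  apply/row_fullP; exists (block_mx L 0 0 L').
  by rewrite mulmx_block !(mulmx0, mul0mx, addr0, add0r) LQ LQ' -scalar_mx_block.
- by rewrite tr_block_mx !trmx0 !mulmx_block !(mulmx0, mul0mx, addr0, add0r).
- by rewrite det_ublock nonsquareM // -unitfE -unitmxE.
Qed.

Lemma form_class_mxdiag k (p_ : 'I_k -> nat) (B : forall i, 'M[F]_(p_ i))
    (r : 'I_k -> nat) (b : 'I_k -> bool) :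
  (forall i, form_class (B i) (r i) (b i)) ->
  form_class (\mxdiag_i B i) (\sum_i r i) (\big[addb/false]_i b i).
Proof.
elim: k p_ B r b => [|k IHk] p_ B r b cB.
  rewrite [X in form_class _ X _]big_ord0 [X in form_class _ _ X]big_ord0; set A := mxdiag _.
  suff -> : A = 0 by apply: form_class_zero.
  by apply/matrixP => -[i i_lt]; exfalso; rewrite big_ord0 in i_lt.
rewrite mxdiag_recl [X in form_class _ X _]big_ord_recl [X in form_class _ _ X]big_ord_recl.
apply: form_class_castmx.
by apply: form_class_block; [apply: cB | apply: IHk].
Qed.

Lemma form_class_copies k n (M : 'M[F]_n) r b :
  form_class M r b -> form_class (copies k M) (k * r) (odd k && b).
Proof.
move=> cM; have := @form_class_mxdiag k (fun=> n) (fun=> M) (fun=> r) (fun=> b) (fun=> cM).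
rewrite [X in form_class _ X _]sum_nat_const card_ord; congr form_class.
by elim: k => [|k]; rewrite ?big_ord0 ?big_ord_recl //= => ->; case: b {cM}; case: odd.
Qed.

(* A maximal independent set of rows of a symmetric matrix cuts out a
   nonsingular principal submatrix. *)
Lemma form_class_principal n (M : 'M[F]_n) : M^T = M ->
  exists (r : nat) (f : 'I_r -> 'I_n),
    [/\ (r <= n)%N, mxsub f f M \in unitmx
      & form_class M r (nonsquare (\det (mxsub f f M)))].
Proof.
move=> MT; exists (\rank M), (maxrankfun M).
set f := maxrankfun M; set N := mxsub f f M.
have Msym i j : M i j = M j i by rewrite -[in LHS]MT mxE.
have NT : N^T = N by apply/matrixP => i j; rewrite !mxE.
(* [Q] expresses all rows through the chosen ones. Restricting to the chosen columns and transposing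
   gives [M = Q N Q^T], which forces both [N] and [Q] to have the rank of [M]. *)
have /submxP[Q MQ] : (M <= rowsub f M)%MS by rewrite eq_maxrowsub.
have colM : colsub f M = Q *m N.
  apply/matrixP => i j; have := congr1 (fun A : 'M_n => A i (f j)) MQ.
  by rewrite !mxE => ->; apply: eq_bigr => k _; rewrite !mxE.
have ME : M = Q *m N *m Q^T.
  rewrite [LHS]MQ -mulmxA; congr (_ *m _).
  by rewrite -[in RHS]NT -trmx_mul -colM; apply/matrixP => i j; rewrite !mxE.
have rM : (\rank M <= \rank N)%N.
  by rewrite [X in (\rank X <= _)%N]ME (leq_trans (mxrankM_maxl _ _)) // mxrankM_maxr.
have uN : N \in unitmx by rewrite -row_free_unit /row_free eqn_leq rank_leq_row.
have fQ : row_full Q.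
  rewrite /row_full eqn_leq rank_leq_col [X in (\rank X <= _)%N]ME -mulmxA.
  exact: mxrankM_maxl.
by split; [exact: rank_leq_row | | exists N, Q].
Qed.

End FiniteFieldForms.

(** * Determinants of graphs on at most five vertices *)

(* A determinant that evaluates by computation, unlike [\det]. *)
Fixpoint laplace (n : nat) (f : nat -> nat -> int) : int :=
  if n is m.+1 then
    foldr (fun j s => (-1) ^+ j * f 0%N j * laplace m (fun a b => f a.+1 (bump j b)) + s)
      0 (iota 0 n)
  else 1.

Lemma laplaceE n (f : nat -> nat -> int) : \det (\matrix_(i < n, j < n) f i j) = laplace n f.
Proof.
elim: n f => [|n IHn] f; first by rewrite det_mx00.
rewrite (expand_det_row _ ord0).
pose G j := (-1) ^+ j * f 0%N j * laplace n (fun a b => f a.+1 (bump j b)).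
transitivity (\sum_(j < n.+1) G j).
  apply: eq_bigr => j _; rewrite mxE /G -IHn /cofactor add0n mulrCA mulrA.
  by congr (_ * \det _); apply/matrixP => a b; rewrite !mxE.
rewrite -(big_mkord xpredT) /index_iota subn0.
rewrite [RHS]/= -/(iota 1 n) -[RHS]/(foldr (fun j s => G j + s) 0 (iota 0 n.+1)).
by elim: (iota 0 n.+1) => [|j s IHs]; rewrite ?big_nil // big_cons IHs.
Qed.

(** Possible determinants of graphs on [n] vertices, for [n] at most 5. That a single vertex gives
    only 0 is what excludes rank 1. *)
Definition small_graph_dets (n : nat) : seq int :=
  nth [::] [:: [:: 1]; [:: 0]; [:: 0; -1]; [:: 0; 2]; [:: 0; 1; -3]; [:: 0; 2; -2; 4; -4]] n.

Lemma small_graph_det n (E : rel nat) : symmetric E -> irreflexive E -> (n <= 5)%N ->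
  laplace n (fun i j => (E i j)%:R) \in small_graph_dets n.
Proof.
move=> Esym Eirr n_le5.
(* The adjacency table of a graph on five vertices in terms of its ten possible edges; smaller
   graphs use a leading block, and what remains is a check of 1024 tables. *)
pose T (a b c d e f g h i j : bool) : seq (seq bool) :=
  [:: [:: false; a; b; c; d]; [:: a; false; e; f; g]; [:: b; e; false; h; i];
      [:: c; f; h; false; j]; [:: d; g; i; j; false]].
pose t s i j : int := (nth false (nth [::] s i) j)%:R.
have -> : laplace n (fun i j => (E i j)%:R) = laplace n (t (T (E 0 1)%N (E 0 2)%N (E 0 3)%N
    (E 0 4)%N (E 1 2)%N (E 1 3)%N (E 1 4)%N (E 2 3)%N (E 2 4)%N (E 3 4)%N)).
  rewrite -!laplaceE; congr (\det _); apply/matrixP => i j; rewrite !mxE.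
  have := leq_trans (ltn_ord i) n_le5; have := leq_trans (ltn_ord j) n_le5.
  case: (val i) (val j) => [|[|[|[|[|//]]]]] [|[|[|[|[|//]]]]] _ _;
    by rewrite /t /= ?Eirr // Esym.
move: (E _ _) (E _ _) (E _ _) (E _ _) (E _ _) (E _ _) (E _ _) (E _ _) (E _ _) (E _ _).
move=> a b c d e f g h i j; set s := T _ _ _ _ _ _ _ _ _ _.
suff /allP : all (fun k => laplace k (t s) \in small_graph_dets k) (iota 0 6).
  by apply; rewrite mem_iota.
by rewrite {}/s; move: a b c d e f g h i j; do 10![case]; vm_compute.
Qed.

(** * Rank and discriminant class of adjacency matrices *)

Section Graphs.

Variable F : finFieldType.
Hypothesis two_neq0 : 2%:R != 0 :> F.

Lemma adjmx_sym (X : sgraph) : (adjmx F X)^T = adjmx F X.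
Proof. by apply/matrixP => i j; rewrite !mxE adj_sym. Qed.

(** [z] is the determinant over the integers of the induced subgraph carrying the nondegenerate
    part, so the list of small determinants serves every characteristic. *)
Lemma form_class_adjmx (X : sgraph) : exists (r : nat) (z : int),
  [/\ (r <= #|vertex X|)%N, (r <= 5)%N -> z \in small_graph_dets r, z%:~R != 0 :> F
    & form_class (adjmx F X) r (nonsquare (z%:~R : F))].
Proof.
have [r [f [r_le uN cX]]] := form_class_principal (adjmx_sym X).
pose e (i j : 'I_r) := adj (enum_val (f i)) (enum_val (f j)).
(* The induced subgraph is extended to a relation on [nat], the form that [laplace] evaluates;
   [inord] requires a nonempty range, hence the separate case of rank 0. *)
have [E [Esym Eirr eE]] : exists E : rel nat,
    [/\ symmetric E, irreflexive E & forall i j, e i j = E i j].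
  case: r => [|r] in f e {r_le uN cX} *.
    by exists (fun _ _ => false); split=> // -[].
  exists (fun i j => e (inord i) (inord j)); split=> [i j|i|i j].
  - exact: adj_sym.
  - exact: adj_irrefl.
  - by rewrite !inord_val.
exists r, (laplace r (fun i j => (E i j)%:R)).
have <- : \det (mxsub f f (adjmx F X)) = (laplace r (fun i j => (E i j)%:R))%:~R.
  rewrite -laplaceE -det_map_mx; congr (\det _).
  by apply/matrixP => i j; rewrite !mxE -eE rmorph_nat.
split=> //; first exact: small_graph_det.
by rewrite -unitfE -unitmxE.
Qed.

Lemma form_class_ordinal_graph k (e : rel 'I_k) (es : symmetric e) (ei : irreflexive e)
    (E : rel nat) (z : int) :
  (forall i j, e i j = E i j) -> laplace k (fun i j => (E i j)%:R) = z -> z%:~R != 0 :> F ->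
  form_class (adjmx F (SGraph es ei)) k (nonsquare (z%:~R : F)).
Proof.
move=> eE <-; rewrite -laplaceE -det_map_mx; set N := map_mx _ _ => dN0.
have -> : adjmx F (SGraph es ei) = castmx (esym (card_ord k), esym (card_ord k)) N.
  apply/matrixP => i j; rewrite castmxE !mxE /= !enum_val_ord eE rmorph_nat.
  by congr (E _ _)%:R.
apply: form_class_castmx; apply: form_class_unit; last by rewrite unitmxE unitfE.
by apply/matrixP => i j; rewrite !mxE -!eE es.
Qed.

Local Notation chi1 := (nonsquare (-1 : F)).
Local Notation chi2 := (nonsquare (2%:R : F)).
Local Notation chi3 := (nonsquare (3%:R : F)).

Let neg1_neq0 : -1 != 0 :> F. Proof. by rewrite oppr_eq0 oner_eq0. Qed.

Let fourE : 4%:R = 2%:R ^+ 2 :> F. Proof. by rewrite -natrX. Qed.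

Let nonsquare4 : nonsquare (4%:R : F) = false.
Proof. by rewrite fourE nonsquare_sqr. Qed.

Let four_neq0 : 4%:R != 0 :> F. Proof. by rewrite fourE; apply: expf_neq0. Qed.

Let nonsquareN (x : F) : x != 0 -> nonsquare (- x) = chi1 (+) nonsquare x.
Proof. by move=> x0; rewrite -[- x]mulN1r nonsquareM. Qed.

Lemma form_class_K1 : form_class (adjmx F (Kn 1)) 0 false.
Proof.
suff -> : adjmx F (Kn 1) = 0 by apply: form_class_zero.
by apply/matrixP => i j; rewrite !mxE /= /complete_adj [enum_val i]ord1 [enum_val j]ord1.
Qed.

Lemma form_class_Kn n (z : int) : laplace n (fun i j => (i != j)%:R) = z ->
  z%:~R != 0 :> F -> form_class (adjmx F (Kn n)) n (nonsquare (z%:~R : F)).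
Proof. by move=> zE z0; apply: form_class_ordinal_graph zE z0. Qed.

Lemma form_class_K2 : form_class (adjmx F (Kn 2)) 2 chi1.
Proof. by apply: (form_class_Kn (z := -1)). Qed.

Lemma form_class_K3 : form_class (adjmx F (Kn 3)) 3 chi2.
Proof. by apply: (form_class_Kn (z := 2)). Qed.

Lemma form_class_K4 : 3%:R != 0 :> F -> form_class (adjmx F (Kn 4)) 4 (chi1 (+) chi3).
Proof.
move=> three_neq0; rewrite -nonsquareN //.
by apply: (form_class_Kn (z := -3)) => //; rewrite oppr_eq0.
Qed.

Let form_class_graph_of_edges n (E : seq (nat * nat)) (z : int) :
  laplace n (fun i j => ((i != j) && (((i, j) \in E) || ((j, i) \in E)))%:R) = z ->
  z%:~R != 0 :> F -> form_class (adjmx F (graph_of_edges n E)) n (nonsquare (z%:~R : F)).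
Proof. by move=> zE z0; apply: form_class_ordinal_graph zE z0. Qed.

Lemma form_class_C5 : form_class (adjmx F C5) 5 chi2.
Proof. by apply: (form_class_graph_of_edges (z := 2)). Qed.

Lemma form_class_B : form_class (adjmx F B) 5 chi1.
Proof.
rewrite -[chi1]addbF -nonsquare4 -nonsquareN //.
by apply: (form_class_graph_of_edges (z := -4)) => //; rewrite oppr_eq0.
Qed.

(** The cases are the square classes of the nonzero values in [small_graph_dets]. In rank 4 the
    value -3 survives only when 3 is nonzero in [F]. *)
Lemma form_class_graph (X : sgraph) : exists (r : nat) (b : bool),
  [/\ (r <= #|vertex X|)%N, form_class (adjmx F X) r b
    & match r with
      | 0 => b = false
      | 1 => False
      | 2 => b = chi1
      | 3 => b = chi2
      | 4 => b = false \/ b = chi1 (+) chi3 /\ 3%:R != 0 :> F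
      | 5 => b \in [:: chi2; chi1 (+) chi2; false; chi1]
      | _ => True
      end].
Proof.
have [r [z [r_le z_small z0 cX]]] := form_class_adjmx X.
exists r, (nonsquare (z%:~R : F)); split=> // {cX r_le}.
have nonsquare1 : nonsquare (1 : F) = false by rewrite -(expr1n F 2) nonsquare_sqr.
case: r z_small => [|[|[|[|[|[|//]]]]]] /(_ isT); rewrite !inE.
- by move/eqP->.
- by move/eqP=> zE; rewrite zE eqxx in z0.
- by case/orP=> /eqP zE; rewrite zE ?eqxx // in z0 *.
- by case/orP=> /eqP zE; rewrite zE ?eqxx // in z0 *.
- case/or3P=> /eqP zE; rewrite zE ?eqxx // in z0 *; first by left.
  right; rewrite [(-3)%:~R](rmorphN _ 3) /= oppr_eq0 in z0 *.
  by rewrite nonsquareN.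
- case/or4P=> [||| /orP[]] /eqP zE; rewrite zE ?eqxx // in z0 *.
  + by rewrite nonsquareN // eqxx orbT.
  + by rewrite nonsquare4 eqxx !orbT.
  + by rewrite nonsquareN // nonsquare4 addbF eqxx !orbT.
Qed.

(** * Decompositions from counts of blocks *)

(** Reduces a decomposition to arithmetic: [ks] counts the blocks, whose ranks and classes are [rs]
    and [bs]. Each block has full rank, so [#|vertex X| - r] copies of [K_1] make the sizes
    agree. *)
Lemma decomposable_of_counts (X : sgraph) (s : seq sgraph) (rs ks : seq nat) (bs : seq bool)
    (r : nat) (b : bool) :
  (r <= #|vertex X|)%N -> form_class (adjmx F X) r b ->
  (forall i, (i < size s)%N -> let Y := nth X s i in
     #|vertex Y| = nth 0%N rs i /\ form_class (adjmx F Y) (nth 0%N rs i) (nth false bs i)) ->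
  r = (\sum_(i < size s) nth 0%N ks i * nth 0%N rs i)%N ->
  b = \big[addb/false]_(i < size s) (odd (nth 0%N ks i) && nth false bs i) ->
  decomposable F X (Kn 1 :: s).
Proof.
move=> r_le cX cs rE bE; exists (fun i => nth 0%N (#|vertex X| - r :: ks)%N i).
apply: (form_class_congruent two_neq0 _ cX).
  rewrite big_ord_recl sum_nat_const /= !card_ord muln1 -[LHS](subnK r_le) [in X in (_ + X)%N]rE.
  congr addn; apply: eq_bigr => i _; rewrite sum_nat_const card_ord.
  by have [nY _] := cs i (ltn_ord i); rewrite -nY.
pose rs' := 0%N :: rs; pose bs' := false :: bs.
suff : form_class (\mxdiag_(i < size (Kn 1 :: s))
      copies (nth 0%N (#|vertex X| - r :: ks)%N i) (adjmx F (nth X (Kn 1 :: s) i)))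
    (\sum_(i < size (Kn 1 :: s)) nth 0%N (#|vertex X| - r :: ks)%N i * nth 0%N rs' i)
    (\big[addb/false]_(i < size (Kn 1 :: s))
       (odd (nth 0%N (#|vertex X| - r :: ks)%N i) && nth false bs' i)).
  rewrite [X in form_class _ X _]big_ord_recl [X in form_class _ _ X]big_ord_recl /=.
  by rewrite muln0 andbF add0n addFb -rE -bE.
apply: form_class_mxdiag => // i; apply: form_class_copies => //.
case: i => -[|i] i_lt /=; first exact: form_class_K1.
by have [] := cs i i_lt.
Qed.

Lemma decomposable_K1234 (X : sgraph) :
  chi1 = false -> chi2 = false -> chi3 = true -> 3%:R != 0 :> F ->
  decomposable F X [:: Kn 1; Kn 2; Kn 3; Kn 4].
Proof.
move=> c1 c2 c3 three_neq0.
have [r [b [r_le cX small]]] := form_class_graph X.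
have [a2 [a3 [a4 [rE bE]]]] : exists a2 a3 a4 : nat,
    r = (a2 * 2 + (a3 * 3 + a4 * 4))%N /\ b = odd a4.
  rewrite c1 c2 c3 !inE -(odd_double_half r) in small *.
  (* Only [K_4] has nonsquare class: take one if [b] holds, one [K_3] if [r] is odd, and fill up
     with [K_2]. The constraints on ranks up to 5 keep the subtraction from truncating. *)
  exists (r./2 - odd r - 2 * b)%N, (odd r : nat), (b : nat).
  by move: (odd r) b r./2 small {cX} => -[] -[] [|[|[|h]]] //=; lia.
apply: (decomposable_of_counts (rs := [:: 2; 3; 4]%N) (ks := [:: a2; a3; a4])
  (bs := [:: chi1; chi2; chi1 (+) chi3]) r_le cX).
- case=> [|[|[|//]]] _ /=; split; rewrite ?card_ord //.
  + exact: form_class_K2.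
  + exact: form_class_K3.
  + exact: form_class_K4.
- by rewrite !big_ord_recl big_ord0 /= addn0.
- by rewrite !big_ord_recl big_ord0 /= c1 c2 c3 bE !andbF andbT !addFb addbF.
Qed.

Lemma decomposable_K1234B (X : sgraph) :
  chi1 = false -> chi2 = true -> chi3 = true -> 3%:R != 0 :> F ->
  decomposable F X [:: Kn 1; Kn 2; Kn 3; Kn 4; B].
Proof.
move=> c1 c2 c3 three_neq0.
have [r [b [r_le cX small]]] := form_class_graph X.
have [a2 [a3 [a4 [a5 [rE bE]]]]] : exists a2 a3 a4 a5 : nat,
    r = (a2 * 2 + (a3 * 3 + (a4 * 4 + a5 * 5)))%N /\ b = odd a3 (+) odd a4.
  rewrite c1 c2 c3 !inE -(odd_double_half r) in small *.
  (* [K_3] and [K_4] have nonsquare class, [K_2] and [B] square class. Besides copies of [K_2], an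
     odd rank takes one [K_3] or one [B] according to [b], an even rank at most one [K_4]. *)
  exists (r./2 - (if odd r then 2 - b else 2 * b))%N,
    (odd r && b : nat), (~~ odd r && b : nat), (odd r && ~~ b : nat).
  by move: (odd r) b r./2 small {cX} => -[] -[] [|[|[|h]]] //=; lia.
apply: (decomposable_of_counts (rs := [:: 2; 3; 4; 5]%N)
  (ks := [:: a2; a3; a4; a5]) (bs := [:: chi1; chi2; chi1 (+) chi3; chi1]) r_le cX).
- case=> [|[|[|[|//]]]] _ /=; split; rewrite ?card_ord //.
  + exact: form_class_K2.
  + exact: form_class_K3.
  + exact: form_class_K4.
  + exact: form_class_B.
- by rewrite !big_ord_recl big_ord0 /= addn0.
- by rewrite !big_ord_recl big_ord0 /= c1 c2 c3 bE !andbF !andbT !addFb addbF.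
Qed.

Lemma decomposable_K1234C5 (X : sgraph) :
  chi1 = true -> chi3 = false -> 3%:R != 0 :> F ->
  decomposable F X [:: Kn 1; Kn 2; Kn 3; Kn 4; C5].
Proof.
move=> c1 c3 three_neq0.
have [r [b [r_le cX small]]] := form_class_graph X.
have [a2 [a3 [a4 [a5 [rE bE]]]]] : exists a2 a3 a4 a5 : nat,
    r = (a2 * 2 + (a3 * 3 + (a4 * 4 + a5 * 5)))%N /\
    b = odd a2 (+) odd a4 (+) (odd (a3 + a5) && chi2).
  rewrite c1 c3 !inE -(odd_double_half r) in small *.
  (* Trading [2 K2] for [K4], or [K2 + K3] for [C5], flips the discriminant class. *)
  pose swap := if odd r then b == (chi2 (+) odd r./2) else b != odd r./2.
  exists (r./2 - (if odd r then 1 + swap else 2 * swap))%N,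
    (odd r && ~~ swap : nat), (~~ odd r && swap : nat), (odd r && swap : nat).
  by move: chi2 (odd r) b r./2 @swap small {cX c1 c3} => -[] -[] -[] [|[|[|h]]] //=; lia.
apply: (decomposable_of_counts (rs := [:: 2; 3; 4; 5]%N)
  (ks := [:: a2; a3; a4; a5]) (bs := [:: chi1; chi2; chi1 (+) chi3; chi2]) r_le cX).
- case=> [|[|[|[|//]]]] _ /=; split; rewrite ?card_ord //.
  + exact: form_class_K2.
  + exact: form_class_K3.
  + exact: form_class_K4.
  + exact: form_class_C5.
- by rewrite !big_ord_recl big_ord0 /= addn0.
- rewrite !big_ord_recl big_ord0 /= c1 c3 bE oddD.
  by case: chi2; do 4!case: odd.
Qed.

Lemma decomposable_K123C5 (X : sgraph) :
  chi1 = true -> (chi3 = true \/ 3%:R = 0 :> F) ->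
  decomposable F X [:: Kn 1; Kn 2; Kn 3; C5].
Proof.
move=> c1 c3.
have [r [b [r_le cX small]]] := form_class_graph X.
have [a2 [a3 [a5 [rE bE]]]] : exists a2 a3 a5 : nat,
    r = (a2 * 2 + (a3 * 3 + a5 * 5))%N /\ b = odd a2 (+) (odd (a3 + a5) && chi2).
  (* Here -3 is a square or zero, so rank 4 only occurs with the class of [2 K_2]. The even trade
     therefore starts at rank 6. *)
  have four : r = 4 -> b = false.
    move=> r4; rewrite r4 in small; case: small => [//|[-> three_neq0]].
    by case: c3 three_neq0 => [->|->]; rewrite ?c1 ?eqxx.
  rewrite c1 !inE -(odd_double_half r) in small four *.
  (* Trading [3 K2] for [2 K3], or [K2 + K3] for [C5], flips the discriminant class. *)
  pose swap := if odd r then b == (chi2 (+) odd r./2) else b != odd r./2.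
  exists (r./2 - (if odd r then 1 + swap else 3 * swap))%N,
    (if odd r then (~~ swap : nat) else 2 * swap)%N, (odd r && swap : nat).
  move: chi2 (odd r) b r./2 @swap small four {cX c1 c3}.
  by move=> -[] -[] -[] [|[|[|h]]] //=; lia.
apply: (decomposable_of_counts (rs := [:: 2; 3; 5]%N) (ks := [:: a2; a3; a5])
  (bs := [:: chi1; chi2; chi2]) r_le cX).
- case=> [|[|[|//]]] _ /=; split; rewrite ?card_ord //.
  + exact: form_class_K2.
  + exact: form_class_K3.
  + exact: form_class_C5.
- by rewrite !big_ord_recl big_ord0 /= addn0.
- rewrite !big_ord_recl big_ord0 /= c1 bE oddD.
  by case: chi2; do 3!case: odd.
Qed.

End Graphs.

(** * The four cases over the prime field *)

Lemma mem_squares p (x : 'F_p) : x \in squares p -> x != 0 /\ nonsquare x = false.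
Proof.
case/imsetP => a; rewrite inE => a0 ->.
by rewrite expf_neq0 // nonsquare_sqr.
Qed.

Lemma mem_nonsquares p (x : 'F_p) : x \in nonsquares p -> x != 0 /\ nonsquare x = true.
Proof.
rewrite !inE => /andP[xS x0]; split=> //; apply: contraNT xS => /nonsquarePn[c xE].
apply/imsetP; exists c => //; rewrite inE; apply: contraNneq x0 => c0.
by rewrite xE c0 expr0n.
Qed.

Theorem theorem2 (p : nat) (p_prime : prime p) (p_odd : odd p) :
  [/\ (-1 \in squares p -> 2%:R \in squares p -> 3%:R \in nonsquares p ->
       forall X : sgraph,
         decomposable 'F_p X [:: Kn 1; Kn 2; Kn 3; Kn 4]),
      (-1 \in squares p -> 2%:R \in nonsquares p -> 3%:R \in nonsquares p ->
       forall X : sgraph,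
         decomposable 'F_p X [:: Kn 1; Kn 2; Kn 3; Kn 4; B]),
      ((5 <= p)%N -> 3%:R \in squares p -> -1 \in nonsquares p ->
       forall X : sgraph,
         decomposable 'F_p X [:: Kn 1; Kn 2; Kn 3; Kn 4; C5])
    & ([/\ (5 <= p)%N, -1 \in nonsquares p & 3%:R \in nonsquares p]
         \/ p = 3%N ->
       forall X : sgraph,
         decomposable 'F_p X [:: Kn 1; Kn 2; Kn 3; C5])].
Proof.
have two_neq0 : 2%:R != 0 :> 'F_p.
  rewrite -(dvdn_pcharf (pchar_Fp p_prime)) dvdn_prime2 //.
  by apply: contraTneq p_odd => ->.
split.
- move=> /mem_squares[_ c1] /mem_squares[_ c2] /mem_nonsquares[three_neq0 c3] X.
  exact: decomposable_K1234.
- move=> /mem_squares[_ c1] /mem_nonsquares[_ c2] /mem_nonsquares[three_neq0 c3] X.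
  exact: decomposable_K1234B.
- move=> _ /mem_squares[three_neq0 c3] /mem_nonsquares[_ c1] X.
  exact: decomposable_K1234C5.
- case=> [[_ /mem_nonsquares[_ c1] /mem_nonsquares[_ c3]]|p3] X.
    by apply: decomposable_K123C5 => //; left.
  subst p; apply: decomposable_K123C5 => //; last by right; apply/val_inj.
  (* -1 is a nonsquare modulo 3, by inspection of the three squares. *)
  by apply/forallP => -[[|[|[|]]]].
Qed.
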